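(* Let $A,B\in M_{d}^{+}$, $X\in M_{d}$, let $|||\cdot|||$ be any unitarily invariant norm on $M_d$, and let $N$ be a nonnegative integer. If $0\leq v\leq1$, then $$|||A^{1-v}XB^{v}+A^{v}XB^{1-v}|||\ \leq\ |||AX+XB|||-\sum_{n=0}^{N-1}r_{n}(v)\sum_{k=1}^{2^{n}}\Delta_{f}(n,k)\,\chi_{\left(\frac{k-1}{2^{n}},\frac{k}{2^{n}}\right)}(v),$$ where $f(u)=|||A^{1-u}XB^{u}+A^{u}XB^{1-u}|||$ for $u\in[0,1]$.
   Context: $M_d$ is the set of $d\times d$ complex matrices and $M_d^+$ the subset of positive definite ones. The functions $r_n:[0,1]\to\mathbb{R}$ are defined recursively by $r_0(v)=\min\{v,1-v\}$ and $r_n(v)=\min\{2r_{n-1}(v),1-2r_{n-1}(v)\}$ for $n\ge 1$. For a function $f$ on $[0,1]$, $\Delta_f(n,k)=f\left(\frac{k-1}{2^n}\right)+f\left(\frac{k}{2^n}\right)-2f\left(\frac{2k-1}{2^{n+1}}\right)$. $\chi_I$ is the characteristic function of the interval $I$. A sum $\sum_{n=0}^{N-1}$ is zero when $N=0$. *)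

(* Defs.v *)
From HB Require Import structures.
From mathcomp Require Export all_boot all_order all_algebra.
From mathcomp Require Export sesquilinear spectral complex.
From mathcomp Require Export all_classical all_reals all_analysis.

Set Implicit Arguments.
Unset Strict Implicit.
Unset Printing Implicit Defensive.

Import Order.TTheory GRing.Theory Num.Theory.

Local Open Scope ring_scope.
Local Open Scope complex_scope.
Local Open Scope sesquilinear_scope.

Section Matrices.
Variables (R : realType) (d : nat).
Implicit Types (A X Y U V : 'M[R[i]]_d).

(* [0 < z] for [z : R[i]] means that [z] is real and strictly positive. *)
Definition posdefmx A : Prop :=
  A \is hermsymmx /\
  forall x : 'cV[R[i]]_d, x != 0 -> 0 < (x^t* *m A *m x) 0 0.

(* Functional calculus. For Hermitian [A], [spectralmx A] is a unitary [P] and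
   [spectral_diag A] the row of (real) eigenvalues, with
   [A = P^t* *m diag_mx (spectral_diag A) *m P]; the result does not depend on
   the diagonalization. [A^u] is the case of [fun a => a `^ u]. *)
Definition mxfun (g : R -> R) A : 'M[R[i]]_d :=
  (spectralmx A)^t*
    *m diag_mx (map_mx (fun z : R[i] => (g (complex.Re z))%:C) (spectral_diag A))
    *m spectralmx A.

Definition mxpowR A (u : R) : 'M[R[i]]_d := mxfun (fun a => a `^ u) A.

(* The norm is an arbitrary function: the norm notation on ['M_d] is
   already attached to the entrywise sup norm. *)
Record unitarily_invariant_norm (nrm : 'M[R[i]]_d -> R) : Prop := {
  uinorm_ge0 : forall X, 0 <= nrm X;
  uinorm_eq0 : forall X, nrm X = 0 -> X = 0;
  uinormD : forall X Y, nrm (X + Y) <= nrm X + nrm Y;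
  uinormZ : forall (c : R[i]) X, nrm (c *: X) = complex.Re `|c| * nrm X;
  uinormU : forall U V X, U \is unitarymx -> V \is unitarymx ->
    nrm (U *m X *m V) = nrm X
}.

End Matrices.

Section Refinement.
Variable R : realType.

Fixpoint rfun (n : nat) (v : R) : R :=
  match n with
  | 0 => Num.min v (1 - v)
  | m.+1 => Num.min (2 * rfun m v) (1 - 2 * rfun m v)
  end.

Definition Delta (f : R -> R) (n k : nat) : R :=
  f ((k%:R - 1) / 2 ^+ n) + f (k%:R / 2 ^+ n)
  - 2 * f ((2 * k%:R - 1) / 2 ^+ n.+1).

End Refinement.

(* Main.v *)
Require Import Defs.
From mathcomp Require Import ring lra zify.
Import Order.TTheory GRing.Theory Num.Theory.
Import numFieldNormedType.Exports.

Set Implicit Arguments.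
Unset Strict Implicit.
Unset Printing Implicit Defensive.

Local Open Scope classical_set_scope.
Local Open Scope ring_scope.
Local Open Scope complex_scope.
Local Open Scope sesquilinear_scope.

(** The bound is the inequality between a convex function and its piecewise
linear interpolant at the points [k / 2 ^ N]. Writing [f] for the norm in the
statement, [f 0 = f 1] is the norm of [A X + X B]; each term [n] of the
correction replaces the interpolant of [f] at level [n] by the one at level
[n + 1], since [rfun n] is a sawtooth of the [n]-th dyadic subdivision and
[Delta f n k] is the gap between the chord and the midpoint of the [k]-th cell
([dyadic_interpolation]). So all the matrix theory goes into the convexity of
[f] ([heinz_convex]).

In eigenbases of [A] and [B], with eigenvalues [exp (x i)] and [exp (y j)], the
matrix inside the norm is the entrywise product of a fixed matrix with the
multiplier [heinz_mult], and with [w = x i - y j]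
  [heinz_mult (s + h) + heinz_mult (s - h) = 2 cosh (h w) heinz_mult s].
Convexity would follow at once if the multiplier [2 cosh (h w)] could not bring
the norm below twice its value. It is enough to know this up to [o(h ^ 2)], as a
continuous function whose second differences are at least [- o(h ^ 2)] is convex
([convex_of_second_difference], by the maximum principle). And up to [o(h ^ 2)]
it is elementary: the multiplier [2 cos (h w)] is the sum of two unitary changes
of basis [Y |-> U Y V], so it at most doubles any unitarily invariant norm
([uinorm_schur_cos]), whereas [2 cosh (h w) + 2 cos (h w) = 4 + o(h ^ 2)]. Hence
[4 |||Y||| <= |||2 cosh (h w) Y||| + 2 |||Y||| + o(h ^ 2)]
([uinorm_schur_cosh]). *)

(** * Dyadic interpolation *)

Lemma dyadic_split (R : realType) (n k : nat) (t : R) :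
  (k%:R + t) / 2 ^+ n.+1 = (k./2%:R + ((odd k)%:R + t) / 2) / 2 ^+ n.
Proof.
rewrite -{1}(odd_double_half k) natrD -muln2 natrM exprS.
have h : (2 : R) ^+ n != 0 by rewrite expf_neq0 // pnatr_eq0.
by field.
Qed.

(** On each cell of level [n], [rfun n] is the distance to the nearest end point,
in units of the cell: the map [r |-> min (2 r) (1 - 2 r)] folds the tent over a
cell onto the two tents over its halves. *)
Lemma rfun_dyadic (R : realType) (n k : nat) (t : R) : (k < 2 ^ n)%N ->
  0 <= t <= 1 -> rfun n ((k%:R + t) / 2 ^+ n) = Num.min t (1 - t).
Proof.
elim: n k t => [|n IHn] k t hk /andP[t0 t1].
  by move: hk; rewrite expn0 ltnS leqn0 => /eqP ->; rewrite add0r expr0 divr1.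
rewrite [LHS]/= dyadic_split IHn; last 2 first.
- by move: hk; rewrite expnS; lia.
- by case: (odd k) => /=; lra.
case: (odd k) => /=.
- rewrite (@min_r _ _ ((1 + t) / 2)); last by lra.
  by rewrite minC; congr Num.min; field.
- rewrite (@min_l _ _ ((0 + t) / 2)); last by lra.
  by congr Num.min; field.
Qed.

Lemma dyadic_cell (R : realType) (N : nat) (v : R) : 0 <= v <= 1 ->
  exists k t, [/\ (k < 2 ^ N)%N, 0 <= t <= 1 & v = (k%:R + t) / 2 ^+ N].
Proof.
move=> v01; elim: N => [|N [k [t [hk /andP[t0 t1] ->]]]].
  by exists 0%N, v; rewrite add0r divr1.
have p0 : (2 : R) ^+ N != 0 by rewrite expf_neq0 // pnatr_eq0.
have [ht|ht] := leP t (1 / 2).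
- exists (k * 2)%N, (2 * t); split; first by rewrite expnS; lia.
  + by apply/andP; split; lra.
  + by rewrite exprS natrM; field.
- exists (k * 2).+1, (2 * t - 1); split; first by rewrite expnS; lia.
  + by apply/andP; split; lra.
  + by rewrite exprS -[(k * 2).+1%:R]natr1 natrM; field.
Qed.

Lemma sum_Delta_dyadic (R : realType) (f : R -> R) (n k : nat) (t : R) :
  (k < 2 ^ n)%N -> 0 < t < 1 ->
  \sum_(1 <= j < (2 ^ n).+1)
     Delta f n j * \1_(`](j%:R - 1) / 2 ^+ n, j%:R / 2 ^+ n[)
                      ((k%:R + t) / 2 ^+ n)
  = Delta f n k.+1.
Proof.
move=> hk /andP[t0 t1].
have p0 : 0 < (2 : R) ^+ n by rewrite exprn_gt0.
rewrite (bigD1_seq k.+1) ?iota_uniq ?mem_index_iota //=.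
rewrite big1 ?addr0 => [|j jk]; rewrite indicE.
  rewrite mem_set ?mulr1 //= in_itv /= !ltr_pM2r ?invr_gt0 //.
  by rewrite -natr1; apply/andP; split; lra.
rewrite memNset ?mulr0 //= in_itv /= !ltr_pM2r ?invr_gt0 // => /andP[h1 h2].
move/eqP: jk; apply.
have h3 : (j < k.+2)%N by rewrite -(ltr_nat R) -[k.+2%:R]natr1 -natr1; lra.
have h4 : (k < j)%N by rewrite -(ltr_nat R); lra.
lia.
Qed.

(** The tent [min t (1 - t)] times [Delta f n k] is what has to be subtracted from
the chord of a cell to bend it down to the value of [f] at the midpoint; the
sum over [n] thus telescopes to the interpolant at level [N]. *)
Lemma dyadic_interpolation (R : realType) (f : R -> R) (N k : nat) (t : R) :
  (k < 2 ^ N)%N -> 0 <= t <= 1 ->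
  let v := (k%:R + t) / 2 ^+ N in
  (1 - v) * f 0 + v * f 1
  - \sum_(0 <= n < N) rfun n v *
      \sum_(1 <= j < (2 ^ n).+1)
        Delta f n j * \1_(`](j%:R - 1) / 2 ^+ n, j%:R / 2 ^+ n[) v
  = (1 - t) * f (k%:R / 2 ^+ N) + t * f (k.+1%:R / 2 ^+ N).
Proof.
elim: N k t => [|n IHn] k t hk /andP[t0 t1] v.
  move: hk; rewrite expn0 ltnS leqn0 => /eqP k0.
  by rewrite big_nil /v k0 expr0 !divr1 add0r subr0.
have hk2 : (k./2 < 2 ^ n)%N by move: hk; rewrite expnS; lia.
set s := ((odd k)%:R + t) / 2.
have hs : 0 <= s <= 1 by rewrite /s; case: (odd k) => /=; lra.
have vE : v = (k./2%:R + s) / 2 ^+ n by rewrite /v dyadic_split.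
have p0 : (2 : R) ^+ n != 0 by rewrite expf_neq0 // pnatr_eq0.
rewrite big_nat_recr //= opprD addrA vE IHn // rfun_dyadic //.
(* At the end points of a cell no open interval contains [v], but there the
   factor [rfun n v] vanishes. *)
have -> : Num.min s (1 - s) * (\sum_(1 <= j < (2 ^ n).+1)
     Delta f n j * \1_(`](j%:R - 1) / 2 ^+ n, j%:R / 2 ^+ n[)
                      ((k./2%:R + s) / 2 ^+ n)) =
   Num.min s (1 - s) * Delta f n k./2.+1.
  have /orP[/orP[/eqP s0|/eqP s1]|hs1] : (s == 0) || (s == 1) || (0 < s < 1).
  - by move: hs; rewrite le_eqVlt eq_sym => /andP[/orP[->//|->]];
       rewrite le_eqVlt => /orP[->|->]; rewrite ?orbT.
  - by rewrite s0 subr0 min_l ?ler01 // !mul0r.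
  - by rewrite s1 subrr min_r ?ler01 // !mul0r.
  - by rewrite sum_Delta_dyadic.
have kE : k = (odd k + k./2 * 2)%N by rewrite -{1}(odd_double_half k) muln2.
have -> : Delta f n k./2.+1 = f (k./2%:R / 2 ^+ n) + f (k./2.+1%:R / 2 ^+ n)
    - 2 * f ((k./2 * 2).+1%:R / 2 ^+ n.+1).
  rewrite /Delta; congr (f (_ / _) + _ - 2 * f (_ / _)).
  - by rewrite -natr1 addrK.
  - by rewrite -!natr1 natrM; ring.
move: hs kE; rewrite /s; move: (odd k) (k./2) => o q hs ->; case: o hs => /= hs.
- rewrite min_r ?add1n; last by lra.
  have -> : (q * 2).+2%:R / 2 ^+ n.+1 = q.+1%:R / 2 ^+ n :> R.
    by rewrite exprS -!natr1 natrM; field.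
  by field.
- rewrite min_l ?add0n ?add0r; last by lra.
  have -> : (q * 2)%:R / 2 ^+ n.+1 = q%:R / 2 ^+ n :> R.
    by rewrite exprS natrM; field.
  by field.
Qed.

(** * Convexity from second differences *)

(** At an interior maximum [s] of [g + e (x - a) (x - b)] the second difference of
[g] would be at most [- 2 e h ^ 2]. *)
Lemma second_difference_max_principle (R : realType) (g : R -> R) (a b : R) :
  continuous g ->
  (forall s e, 0 < e ->
    \forall h \near 0^'+, 2 * g s - e * h ^+ 2 <= g (s + h) + g (s - h)) ->
  g a <= 0 -> g b <= 0 -> forall c, a <= c <= b -> g c <= 0.
Proof.
move=> gc gmid ga gb c /andP[ac cb]; rewrite leNgt; apply/negP => gc0.
have {}ac : a < c.
  by rewrite lt_neqAle ac andbT; apply: contraTneq gc0 => <-; rewrite -leNgt.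
have {}cb : c < b.
  by rewrite lt_neqAle cb andbT; apply: contraTneq gc0 => ->; rewrite -leNgt.
(* Chosen so that the perturbation lowers the value at [c] by half only. *)
pose e := g c / (2 * ((c - a) * (b - c))).
have p0 : 0 < (c - a) * (b - c) by rewrite mulr_gt0 // subr_gt0.
have e0 : 0 < e by rewrite divr_gt0 // mulr_gt0.
pose k x := g x + e * ((x - a) * (x - b)).
have kc : continuous k.
  move=> x; apply: cvgD; first exact: gc.
  apply: cvgM; first exact: cvg_cst.
  by apply: cvgM; apply: cvgB; (exact: cvg_id || exact: cvg_cst).
have [s sab smax] :=
  @EVT_max R k a b (ltW (lt_trans ac cb)) (continuous_subspaceT kc).
have ks0 : 0 < k s.
  apply: lt_le_trans (smax c _); last by rewrite in_itv /= !ltW.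
  rewrite /k.
  have -> : e * ((c - a) * (c - b)) = - (g c / 2).
    by rewrite /e; field; rewrite !subr_eq0 !gt_eqF.
  lra.
move: sab; rewrite in_itv /= => /andP[sa sb].
have {}sa : a < s.
  rewrite lt_neqAle sa andbT; apply: contraTneq ks0 => <-.
  by rewrite -leNgt /k subrr mul0r mulr0 addr0.
have {}sb : s < b.
  rewrite lt_neqAle sb andbT; apply: contraTneq ks0 => ->.
  by rewrite -leNgt /k subrr mulr0 mulr0 addr0.
have [h [h0 ha hb]] : exists h, [/\ 0 < h, h < s - a, h < b - s &
    2 * g s - e * h ^+ 2 <= g (s + h) + g (s - h)].
  near (0 : R)^'+ => h; exists h; split; near: h.
  - exact: nbhs_right_gt.
  - by apply: nbhs_right_lt; rewrite subr_gt0.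
  - by apply: nbhs_right_lt; rewrite subr_gt0.
  - exact: gmid.
have := smax (s + h) _; have := smax (s - h) _; rewrite !in_itv /=.
move=> /(_ ltac:(by apply/andP; split; lra)) h1.
move=> /(_ ltac:(by apply/andP; split; lra)) h2.
have : 0 < e * h ^+ 2 by rewrite mulr_gt0 // exprn_gt0.
move: h1 h2; rewrite /k; nra.
Unshelve. all: by end_near.
Qed.

Lemma convex_of_second_difference (R : realType) (f : R -> R) :
  continuous f ->
  (forall s e, 0 < e ->
    \forall h \near 0^'+, 2 * f s - e * h ^+ 2 <= f (s + h) + f (s - h)) ->
  forall a b t, a < b -> 0 <= t <= 1 ->
  f ((1 - t) * a + t * b) <= (1 - t) * f a + t * f b.
Proof.
move=> fc fmid a b t ab t01.
pose l x := f a + (x - a) * ((f b - f a) / (b - a)).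
have ba : b - a != 0 by rewrite subr_eq0 gt_eqF.
have lE : l ((1 - t) * a + t * b) = (1 - t) * f a + t * f b.
  by rewrite /l; field.
rewrite -lE -subr_le0.
apply: (@second_difference_max_principle R (fun x => f x - l x) a b).
- move=> x; apply: cvgB; first exact: fc.
  apply: cvgD; first exact: cvg_cst.
  by apply: cvgM; [apply: cvgB; [exact: cvg_id|exact: cvg_cst]|exact: cvg_cst].
- move=> s e e0; near=> h.
  have : 2 * f s - e * h ^+ 2 <= f (s + h) + f (s - h) by near: h; exact: fmid.
  have : l (s + h) + l (s - h) = 2 * l s by rewrite /l; ring.
  lra.
- by rewrite /l subrr mul0r addr0 subrr.
- by rewrite /l mulrCA divff // mulr1 [f a + _]addrC subrK subrr.
- move/andP: t01 => [t0 t1]; apply/andP; split; nra.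
Unshelve. all: by end_near.
Qed.

(** The right-hand side is the interpolant of [f] at the points [k / 2 ^ N], and
the graph of [f] lies below its chord over the cell of [v]. *)
Lemma convex_dyadic_refinement (R : realType) (f : R -> R) (N : nat) (v : R) :
  (forall a b t, a < b -> 0 <= t <= 1 ->
     f ((1 - t) * a + t * b) <= (1 - t) * f a + t * f b) ->
  0 <= v <= 1 ->
  f v <= (1 - v) * f 0 + v * f 1
    - \sum_(0 <= n < N) rfun n v *
        \sum_(1 <= k < (2 ^ n).+1)
          Delta f n k * \1_(`](k%:R - 1) / 2 ^+ n, k%:R / 2 ^+ n[) v.
Proof.
move=> fconv hv.
have [k [t [hk ht vE]]] := dyadic_cell N hv.
have := dyadic_interpolation f hk ht; rewrite /= -vE => ->.
have cell : k%:R / 2 ^+ N < k.+1%:R / 2 ^+ N :> R.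
  by rewrite ltr_pM2r ?invr_gt0 ?exprn_gt0 // ltr_nat.
have := fconv _ _ _ cell ht.
rewrite (_ : (1 - t) * _ + _ = v) //.
by rewrite vE -[k.+1%:R]natr1; ring.
Qed.

(** * Multipliers and unitarily invariant norms *)

(** Real multipliers suffice, as powers of eigenvalues and cosines are real. *)
Definition schur (R : realType) (d : nat) (c : 'I_d -> 'I_d -> R)
    (Y : 'M[R[i]]_d) : 'M[R[i]]_d :=
  \matrix_(i, j) ((c i j)%:C * Y i j).

Lemma Re_normR (R : realType) (c : R) : complex.Re `|c%:C| = `|c|.
Proof. by rewrite normc_def /= expr0n addr0 sqrtr_sqr. Qed.

Lemma Re_normM (R : realType) (z w : R[i]) :
  complex.Re `|z * w| = complex.Re `|z| * complex.Re `|w|.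
Proof. by rewrite normrM !normc_def /= !mul0r subr0. Qed.

Lemma uinorm_le_sum (R : realType) (d : nat) (nrm : 'M[R[i]]_d -> R) :
  unitarily_invariant_norm nrm -> forall Y,
  nrm Y <= \sum_i \sum_j complex.Re `|Y i j| * nrm (delta_mx i j).
Proof.
move=> hn Y.
have n0 : nrm 0 = 0 by rewrite -(scale0r 0) (uinormZ hn) normr0 mul0r.
have nsum (I : Type) (r : seq I) (F : I -> 'M[R[i]]_d) :
    nrm (\sum_(k <- r) F k) <= \sum_(k <- r) nrm (F k).
  elim: r => [|k r IH]; first by rewrite !big_nil n0.
  by rewrite !big_cons (le_trans (uinormD hn _ _)) // lerD2l.
rewrite {1}(matrix_sum_delta Y); apply: (le_trans (nsum _ _ _)).
apply: ler_sum => i _; apply: (le_trans (nsum _ _ _)).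
by apply: ler_sum => j _; rewrite (uinormZ hn).
Qed.

(** As [w] does not depend on [c], the entrywise convergence of multipliers
gives the convergence of norms. *)
Lemma uinorm_schur_le (R : realType) (d : nat) (nrm : 'M[R[i]]_d -> R) Y :
  unitarily_invariant_norm nrm ->
  exists w : 'I_d -> 'I_d -> R,
  forall c, nrm (schur c Y) <= \sum_i \sum_j `|c i j| * w i j.
Proof.
move=> hn; exists (fun i j => complex.Re `|Y i j| * nrm (delta_mx i j)) => c.
apply: (le_trans (uinorm_le_sum hn _)).
apply: ler_sum => i _; apply: ler_sum => j _.
by rewrite mxE Re_normM Re_normR mulrA.
Qed.

Definition phase (R : realType) (d : nat) (x : 'I_d -> R) : 'M[R[i]]_d :=
  diag_mx (\row_i (cos (x i) +i* sin (x i))).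

Lemma phase_unitary (R : realType) (d : nat) (x : 'I_d -> R) :
  phase x \is unitarymx.
Proof.
apply/unitarymxP; apply/matrixP => i j.
rewrite /phase tr_diag_mx map_diag_mx mul_diag_mx !mxE.
case: eqVneq => [->|_]; rewrite ?mulr0n ?mulr0 // !mulr1n.
apply/eqP; rewrite eq_complex /=; apply/andP; split; apply/eqP.
  by rewrite mulrN opprK -!expr2 cos2Dsin2.
by rewrite mulrN mulrC addrC subrr.
Qed.

(** [cos (x i - y j)] is the average of [exp (i x) exp (- i y)] and its conjugate,
that is, of two products of [Y] by diagonal unitaries. *)
Lemma uinorm_schur_cos (R : realType) (d : nat) (nrm : 'M[R[i]]_d -> R)
    (x y : 'I_d -> R) Y :
  unitarily_invariant_norm nrm ->
  nrm (schur (fun i j => 2 * cos (x i - y j)) Y) <= 2 * nrm Y.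
Proof.
move=> hn.
have -> : schur (fun i j => 2 * cos (x i - y j)) Y
  = phase x *m Y *m phase (fun j => - y j)
    + phase (fun i => - x i) *m Y *m phase y.
  apply/matrixP => i j; rewrite /phase !mul_diag_mx !mul_mx_diag !mxE.
  rewrite !cosN !sinN cosB; case: (Y i j) => p q.
  by apply/eqP; rewrite eq_complex /=; apply/andP; split; apply/eqP; ring.
rewrite (le_trans (uinormD hn _ _)) // !(uinormU hn) ?phase_unitary //.
by rewrite mulr_natl.
Qed.

Lemma cvg_slope0 (R : realType) (f : R -> R) (l : R) :
  f 0 = 0 -> is_derive (0 : R) (1 : R) f l -> (fun h => f h / h) @ 0^'+ --> l.
Proof.
move=> f0 [df <-]; apply: cvg_dnbhs_at_right.
have -> : (fun h => f h / h) =
    (fun h : R => h^-1 *: ((f \o shift 0) (h *: (1 : R)) - f 0)).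
  by apply/funext => h; rewrite /= f0 subr0 addr0 [h *: _]mulr1 mulrC.
exact: df.
Qed.

(** Writing [z = h w / 2], the numerator is [4 (sinh z ^ 2 - sin z ^ 2)], and
[sinh z] and [sin z] are both equivalent to [z]. *)
Lemma cosh_add_cos_small (R : realType) (w : R) :
  (fun h : R =>
     (expR (h * w) + expR (- (h * w)) + 2 * cos (h * w) - 4) / h ^+ 2)
   @ 0^'+ --> (0 : R).
Proof.
(* Both [S] and [T] have slope [w] at [0]. *)
pose S (h : R) : R := expR (h * (w / 2)) - expR (- (h * (w / 2))).
pose T (h : R) : R := 2 * sin (h * (w / 2)).
have hS : (fun h => S h / h) @ 0^'+ --> w.
  apply: cvg_slope0; first by rewrite /S mul0r oppr0 subrr.
  by apply: is_derive_eq; rewrite mul0r oppr0 expR0 /GRing.scale /=; field.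
have hT : (fun h => T h / h) @ 0^'+ --> w.
  apply: cvg_slope0; first by rewrite /T mul0r sin0 mulr0.
  by apply: is_derive_eq; rewrite mul0r cos0 ?sin0 /GRing.scale /=; field.
have lim : (S h / h) * (S h / h) - (T h / h) * (T h / h)
    @[h --> (0 : R)^'+] --> (0 : R).
  by rewrite -[X in _ --> X](subrr (w * w)); apply: cvgB; apply: cvgM.
apply: (cvg_trans _ lim); apply: near_eq_cvg; near=> h.
have h0 : h != 0 by rewrite gt_eqF //; near: h; exact: nbhs_right_gt.
rewrite /S /T /=.
have -> : h * w = h * (w / 2) + h * (w / 2) by field.
set z := h * (w / 2).
rewrite cosD opprD !expRD -[cos z * cos z]expr2 cos2sin2.
have : expR z * expR (- z) = 1 by rewrite expRN divff // gt_eqF // expR_gt0.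
move: (expR z) (expR (- z)) (sin z) => p q r pq.
have -> : p * p + q * q = (p - q) ^+ 2 + 2 * (p * q) by ring.
by rewrite pq; field.
Unshelve. all: by end_near.
Qed.

Lemma cvg_weighted_sum0 (R : realType) (d : nat) (F : set_system R)
    (FF : Filter F) (c : R -> 'I_d -> 'I_d -> R) (w : 'I_d -> 'I_d -> R) :
  (forall i j, c h i j @[h --> F] --> (0 : R)) ->
  \sum_i \sum_j `|c h i j| * w i j @[h --> F] --> (0 : R).
Proof.
move=> hc.
rewrite [X in _ --> X](_ : _ = \sum_(i < d) \sum_(j < d) `|0 : R| * w i j).
  apply: cvg_big => [|i _]; first exact: add_continuous.
  apply: cvg_big => [|j _]; first exact: add_continuous.
  apply: cvgM; last exact: cvg_cst.
  by apply: cvg_norm; exact: hc.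
by rewrite normr0 big1 // => i _; rewrite big1 // => j _; rewrite mul0r.
Qed.

(** Split [4 Y] by multipliers into a [cosh] part, a [cos] part and a remainder
of order [o(h ^ 2)]; the [cos] part costs at most [2 nrm Y]. *)
Lemma uinorm_schur_cosh (R : realType) (d : nat) (nrm : 'M[R[i]]_d -> R)
    (x y : 'I_d -> R) Y :
  unitarily_invariant_norm nrm -> forall e, 0 < e ->
  \forall h \near (0 : R)^'+, 2 * nrm Y - e * h ^+ 2 <=
    nrm (schur (fun i j =>
      expR (h * (x i - y j)) + expR (- (h * (x i - y j)))) Y).
Proof.
move=> hn e e0.
have [w hw] := uinorm_schur_le Y hn.
pose D (h : R) i j : R := expR (h * (x i - y j)) + expR (- (h * (x i - y j)))
   + 2 * cos (h * (x i - y j)) - 4.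
have small : \sum_i \sum_j `|D h i j / h ^+ 2| * w i j
    @[h --> (0 : R)^'+] --> (0 : R).
  by apply: cvg_weighted_sum0 => i j; exact: cosh_add_cos_small.
near=> h.
have h0 : 0 < h by near: h; exact: nbhs_right_gt.
have hD : \sum_i \sum_j `|D h i j / h ^+ 2| * w i j <= e.
  by near: h; apply: (cvgr_le _ small).
pose Ych := schur (fun i j =>
  expR (h * (x i - y j)) + expR (- (h * (x i - y j)))) Y.
pose Yc := schur (fun i j => 2 * cos (h * x i - h * y j)) Y.
pose YD := schur (fun i j => - D h i j) Y.
have E : 4%:C *: Y = Ych + Yc + YD.
  apply/matrixP => i j; rewrite !mxE -!mulrDl -!rmorphD /=; congr (_%:C * _).
  by rewrite /D mulrBr; ring.
have : nrm (4%:C *: Y) = 4 * nrm Y by rewrite (uinormZ hn) Re_normR ger0_norm.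
rewrite E => E'.
have := uinormD hn (Ych + Yc) YD; have := uinormD hn Ych Yc.
have := uinorm_schur_cos (fun i => h * x i) (fun i => h * y i) Y hn.
rewrite -/Yc -/Ych.
have : nrm YD <= e * h ^+ 2.
  apply: (le_trans (hw _)).
  rewrite -ler_pdivrMr ?exprn_gt0 // mulr_suml.
  apply: le_trans hD; apply: ler_sum => i _; rewrite mulr_suml.
  apply: ler_sum => j _.
  by rewrite normrN normrM normfV (ger0_norm (ltW (exprn_gt0 _ h0))) mulrAC.
rewrite E'; lra.
Unshelve. all: by end_near.
Qed.

Lemma continuous_uinorm_schur (R : realType) (d : nat) (nrm : 'M[R[i]]_d -> R)
    (m : R -> 'I_d -> 'I_d -> R) Y :
  unitarily_invariant_norm nrm -> (forall i j, continuous (fun u => m u i j)) ->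
  continuous (fun u => nrm (schur (m u) Y)).
Proof.
move=> hn hm s.
have [w hw] := uinorm_schur_le Y hn.
have small : \sum_i \sum_j `|m s i j - m u i j| * w i j @[u --> s] --> (0 : R).
  apply: cvg_weighted_sum0 => i j; rewrite -[X in _ --> X](subrr (m s i j)).
  by apply: cvgB; [exact: cvg_cst|exact: hm].
apply/cvgrPdist_le => e e0; near=> u.
have sm : \sum_i \sum_j `|m s i j - m u i j| * w i j <= e.
  by near: u; apply: (cvgr_le _ small).
have tri (p q : R) :
    nrm (schur (m p) Y) <= nrm (schur (m q) Y)
      + \sum_i \sum_j `|m p i j - m q i j| * w i j.
  have -> : schur (m p) Y = schur (m q) Y + schur (fun i j => m p i j - m q i j) Y.
    by apply/matrixP => i j; rewrite !mxE -mulrDl -rmorphD /=; congr (_%:C * _); ring.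
  by rewrite (le_trans (uinormD hn _ _)) // lerD2l.
have := tri s u; have := tri u s.
rewrite (eq_bigr (fun i => \sum_j `|m s i j - m u i j| * w i j)); last first.
  by move=> i _; apply: eq_bigr => j _; rewrite distrC.
rewrite ler_norml; lra.
Unshelve. all: by end_near.
Qed.

(** Its value is [a ^ (1 - u) b ^ u + a ^ u b ^ (1 - u)] for [a = exp (x i)] and
[b = exp (y j)]. *)
Definition heinz_mult (R : realType) (d : nat) (x y : 'I_d -> R) (u : R)
    (i j : 'I_d) : R :=
  expR ((1 - u) * x i + u * y j) + expR (u * x i + (1 - u) * y j).

(** The sum of the multipliers at [s + h] and [s - h] is [2 cosh (h (x i - y j))]
times the one at [s]. *)
Lemma heinz_convex (R : realType) (d : nat) (nrm : 'M[R[i]]_d -> R)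
    (x y : 'I_d -> R) Y : unitarily_invariant_norm nrm ->
  let f u := nrm (schur (heinz_mult x y u) Y) in
  forall a b t, a < b -> 0 <= t <= 1 ->
  f ((1 - t) * a + t * b) <= (1 - t) * f a + t * f b.
Proof.
move=> hn f; apply: convex_of_second_difference.
  apply: continuous_uinorm_schur => // i j u.
  apply: cvgD; (apply: continuous_comp; last exact: continuous_expR).
  - apply: cvgD; apply: cvgM; try exact: cvg_cst; try exact: cvg_id.
    by apply: cvgB; [exact: cvg_cst|exact: cvg_id].
  - apply: cvgD; apply: cvgM; try exact: cvg_cst; try exact: cvg_id.
    by apply: cvgB; [exact: cvg_cst|exact: cvg_id].
move=> s e e0.
have := uinorm_schur_cosh x y (schur (heinz_mult x y s) Y) hn e0.
apply: filterS => h /le_trans; apply.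
have -> : schur (fun i j => expR (h * (x i - y j)) + expR (- (h * (x i - y j))))
     (schur (heinz_mult x y s) Y)
   = schur (heinz_mult x y (s + h)) Y + schur (heinz_mult x y (s - h)) Y.
  apply/matrixP => i j; rewrite !mxE mulrA -rmorphM -mulrDl -rmorphD /=.
  congr (_%:C * _); rewrite /heinz_mult; move: (x i) (y j) => a b.
  have -> : (1 - (s + h)) * a + (s + h) * b
    = (1 - s) * a + s * b + - (h * (a - b)) by ring.
  have -> : (s + h) * a + (1 - (s + h)) * b
    = s * a + (1 - s) * b + h * (a - b) by ring.
  have -> : (1 - (s - h)) * a + (s - h) * b
    = (1 - s) * a + s * b + h * (a - b) by ring.
  have -> : (s - h) * a + (1 - (s - h)) * b
    = s * a + (1 - s) * b + - (h * (a - b)) by ring.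
  by rewrite !(expRD _ (h * _)) !(expRD _ (- (h * _))); ring.
exact: uinormD.
Qed.

(** * Real powers in an eigenbasis *)

(** The logarithms [x i] of the eigenvalues turn all real powers into
exponentials, uniformly in the exponent. *)
Lemma mxpowR_diag (R : realType) (d : nat) (A : 'M[R[i]]_d) : posdefmx A ->
  exists2 x : 'I_d -> R,
   (forall u, mxpowR A u = (spectralmx A)^t* *m diag_mx (\row_i (expR (u * x i))%:C)
     *m spectralmx A) & A = mxpowR A 1 /\ mxpowR A 0 = 1%:M.
Proof.
move=> [hA pA].
set P := spectralmx A; set D := spectral_diag A.
have PU : P \is unitarymx := spectral_unitarymx A.
have AE : A = P^t* *m diag_mx D *m P.
  by rewrite -invmx_unitary //; apply/orthomx_spectralP/hermitian_normalmx.
have Dpos i : 0 < D 0 i.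
  (* An eigenvector, on which the quadratic form takes the value [D 0 i]. *)
  have x0 : (P^t*) *m delta_mx i 0 != 0 :> 'cV_d.
    apply: contraTneq isT => /(congr1 (mulmx P)).
    rewrite mulmxA (unitarymxP PU) mul1mx mulmx0 => /matrixP/(_ i 0).
    by rewrite !mxE !eqxx => /eqP; rewrite oner_eq0.
  have := pA _ x0; rewrite AE.
  rewrite trmx_mul map_mxM trmxCK -!mulmxA (mulmxA P) (unitarymxP PU) mul1mx.
  rewrite (mulmxA P) (unitarymxP PU) mul1mx trmx_delta map_delta_mx.
  by rewrite mul_diag_mx -rowE !mxE !eqxx mulr1.
pose a i := complex.Re (D 0 i).
have aD i : D 0 i = (a i)%:C.
  by rewrite /a RRe_real // gtr0_real.
have a0 i : 0 < a i by rewrite -ltcR -aD.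
have powE u : mxpowR A u = P^t* *m diag_mx (\row_i (expR (u * ln (a i)))%:C) *m P.
  rewrite /mxpowR /mxfun -/P -/D; congr (_ *m diag_mx _ *m _).
  by apply/rowP => i; rewrite !mxE -/(a i) /powR gt_eqF.
exists (fun i => ln (a i)) => //; split.
  rewrite powE {1}AE; congr (_ *m diag_mx _ *m _); apply/rowP => i.
  by rewrite mxE mul1r lnK // posrE.
rewrite powE.
have -> : (\row_i (expR (0 * ln (a i)))%:C) = const_mx 1.
  by apply/rowP => i; rewrite !mxE mul0r expR0.
by rewrite diag_const_mx mulmx1 -invmx_unitary // mulVmx // unitarymx_unit.
Qed.

Theorem theorem15 (R : realType) (d : nat) (A B X : 'M[R[i]]_d)
    (nrm : 'M[R[i]]_d -> R) (N : nat) (v : R)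
    (hA : posdefmx A) (hB : posdefmx B)
    (hnrm : unitarily_invariant_norm nrm)
    (hv : 0 <= v <= 1) :
  let f := fun u : R =>
    nrm (mxpowR A (1 - u) *m X *m mxpowR B u
         + mxpowR A u *m X *m mxpowR B (1 - u)) in
  nrm (mxpowR A (1 - v) *m X *m mxpowR B v
       + mxpowR A v *m X *m mxpowR B (1 - v))
  <= nrm (A *m X + X *m B)
     - \sum_(0 <= n < N) rfun n v *
         \sum_(1 <= k < (2 ^ n).+1)
           Delta f n k *
           \1_(`](k%:R - 1) / 2 ^+ n, k%:R / 2 ^+ n[) v.
Proof.
cbv zeta.
pose f u := nrm (mxpowR A (1 - u) *m X *m mxpowR B u
                 + mxpowR A u *m X *m mxpowR B (1 - u)).
have [x powA [A1 A0]] := mxpowR_diag hA.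
have [y powB [B1 B0]] := mxpowR_diag hB.
set P := spectralmx A in powA; set Q := spectralmx B in powB.
have PU : P \is unitarymx := spectral_unitarymx A.
have QU : Q \is unitarymx := spectral_unitarymx B.
pose Y := P *m X *m Q^t*.
have fE u : f u = nrm (schur (heinz_mult x y u) Y).
  rewrite -(uinormU hnrm (U := P^t*) (V := Q)) ?trmxC_unitary //; congr nrm.
  rewrite !powA !powB.
  have conj (D E : 'rV[R[i]]_d) :
      P^t* *m diag_mx D *m P *m X *m (Q^t* *m diag_mx E *m Q)
    = P^t* *m (diag_mx D *m Y *m diag_mx E) *m Q by rewrite /Y !mulmxA.
  rewrite !conj -mulmxDl -mulmxDr; congr (_ *m _ *m _).
  apply/matrixP => i j; rewrite !mul_diag_mx !mul_mx_diag.
  rewrite mxE [RHS]mxE /heinz_mult !expRD rmorphD !rmorphM /= !mxE.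
  by ring.
have f0 : f 0 = nrm (A *m X + X *m B).
  by rewrite /f subr0 -A1 A0 -B1 B0 mulmx1 mul1mx.
have f1 : f 1 = f 0 by rewrite /f subr0 subrr addrC.
have fconv a b t : a < b -> 0 <= t <= 1 ->
    f ((1 - t) * a + t * b) <= (1 - t) * f a + t * f b.
  by rewrite !fE; exact: heinz_convex.
have main := convex_dyadic_refinement N fconv hv.
rewrite (_ : (1 - v) * f 0 + v * f 1 = nrm (A *m X + X *m B)) in main.
  exact: main.
by rewrite f1 f0; ring.
Qed.
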